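(* Every matrogenic graph has the strong Havel--Hakimi property. Hence every matroidal graph and every threshold graph also has the strong Havel--Hakimi property.
   Context: All graphs are finite and simple. A vertex $v$ of a graph $G$ has the Havel--Hakimi property (in $G$) if $v$ has maximum degree in $G$ and no vertex adjacent to $v$ has degree smaller than that of some vertex not adjacent to $v$; that is, $d_G(w)\ge d_G(u)$ for every neighbor $w$ of $v$ and every vertex $u\neq v$ not adjacent to $v$. A graph $G$ has the strong Havel--Hakimi property if in every induced subgraph $H$ of $G$, every vertex of maximum degree in $H$ has the Havel--Hakimi property in $H$. An alternating 4-cycle in $G$ is a configuration on four distinct vertices $a,b,c,d$ of $G$ in which $ab$ and $cd$ are edges and $ac$ and $bd$ are non-edges (no condition on the pairs $ad$, $bc$). A set of four vertices is the vertex set of an alternating 4-cycle if and only if it induces $2K_2$, $P_4$ or $C_4$. A graph $G$ is matrogenic if the vertex sets of the alternating 4-cycles of $G$ are the circuits of a matroid with ground set $V(G)$. A graph $G$ is matroidal if the edge sets $\{ab,cd\}$ of the alternating 4-cycles of $G$ are the circuits of a matroid with ground set $E(G)$. A graph is a threshold graph if it contains no alternating 4-cycle (equivalently, it has no induced subgraph isomorphic to $2K_2$, $P_4$, or $C_4$). *)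

(* Defs.v *)
From mathcomp Require Import all_boot.

Set Implicit Arguments.
Unset Strict Implicit.
Unset Printing Implicit Defensive.

Record sgraph := SGraph {
  vertex :> finType;
  adj : rel vertex;
  adj_sym : symmetric adj;
  adj_irrefl : irreflexive adj
}.

Section Induced.
Variables (G : sgraph) (S : {set G}).

Definition induced_adj : rel {x : G | x \in S} := relpre val (@adj G).

Lemma induced_adj_sym : symmetric induced_adj.
Proof. by move=> x y; apply: adj_sym. Qed.

Lemma induced_adj_irrefl : irreflexive induced_adj.
Proof. by move=> x; apply: adj_irrefl. Qed.

Definition induced : sgraph := SGraph induced_adj_sym induced_adj_irrefl.
End Induced.

Definition degree (G : sgraph) (v : G) : nat := #|[set w | adj v w]|.

Definition max_degree (G : sgraph) (v : G) : Prop :=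
  forall w : G, degree w <= degree v.

Definition havel_hakimi (G : sgraph) (v : G) : Prop :=
  max_degree v /\
  forall w u : G, adj v w -> u != v -> ~~ adj v u -> degree u <= degree w.

Definition strong_havel_hakimi (G : sgraph) : Prop :=
  forall (S : {set G}) (v : induced S), max_degree v -> havel_hakimi v.

Definition alternating4 (G : sgraph) (a b c d : G) : bool :=
  [&& uniq [:: a; b; c; d], adj a b, adj c d, ~~ adj a c & ~~ adj b d].

(* A matroid whose ground set is the whole type E, given by its independent
   sets. *)
Record matroid (E : finType) := Matroid {
  indep : {set {set E}};
  indep0 : set0 \in indep;
  indepS : forall I J : {set E}, J \in indep -> I \subset J -> I \in indep;
  indep_aug : forall I J : {set E}, I \in indep -> J \in indep -> #|I| < #|J| ->
    exists2 x, x \in J :\: I & x |: I \in indep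
}.

Definition circuit (E : finType) (M : matroid E) (C : {set E}) : bool :=
  minset [pred X : {set E} | X \notin indep M] C.

Definition edges (G : sgraph) : {set {set G}} :=
  [set [set p.1; p.2] | p : G * G & adj p.1 p.2].

Definition edge (G : sgraph) : finType := {e : {set G} | e \in edges G}.

Definition alternating4_vertex_set (G : sgraph) (A : {set G}) : Prop :=
  exists a b c d : G, alternating4 a b c d /\ A = [set a; b; c; d].

Definition alternating4_edge_set (G : sgraph) (F : {set edge G}) : Prop :=
  exists (a b c d : G) (e f : edge G),
    [/\ alternating4 a b c d, val e = [set a; b], val f = [set c; d]
      & F = [set e; f]].

Definition matrogenic (G : sgraph) : Prop :=
  exists M : matroid G, forall C : {set G},
    circuit M C <-> alternating4_vertex_set C.

Definition matroidal (G : sgraph) : Prop :=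
  exists M : matroid (edge G), forall C : {set edge G},
    circuit M C <-> alternating4_edge_set C.

Definition threshold (G : sgraph) : Prop :=
  forall a b c d : G, ~~ alternating4 a b c d.

(* Main.v *)
Require Import Defs.
From mathcomp Require Import all_boot.

(** If [u] is not adjacent to [v] but has larger degree than the neighbor [w] of
    [v], then counting [N(u) \ N(w)] against [N(w) \ N(u)], which contains [v],
    yields two vertices [x], [y] adjacent to [u] and not to [w], so that
    [v w u x] and [v w u y] are both alternating 4-cycles. In the matrogenic
    case, eliminating [v] from these two circuits makes [{w, u, x, y}] an
    alternating 4-cycle; there [w] can only be adjacent to [u], and then [u] is
    adjacent to all the others. In the matroidal case, eliminating the edge [vw]
    leaves only [ux] and [uy], which are not disjoint. *)

Set Implicit Arguments.
Unset Strict Implicit.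
Unset Printing Implicit Defensive.

(** Were [J] independent, take [g] in [C2] but not [C1] and extend [C2 :\ g], independent by
    minimality of [C2], to a maximal independent set [I] inside [C1 :|: C2]. Then [J] would be
    larger than [I], and augmenting [I] from [J] would contradict maximality. *)
Lemma circuit_elimination (E : finType) (M : matroid E) (C1 C2 : {set E}) e :
  circuit M C1 -> circuit M C2 -> C1 != C2 -> e \in C1 -> e \in C2 ->
  exists2 C : {set E}, circuit M C & C \subset (C1 :|: C2) :\ e.
Proof.
move=> cC1 cC2 neqC eC1 eC2.
have [/= depC1 _] := minsetP cC1; have [/= depC2 minC2] := minsetP cC2.
set J := (C1 :|: C2) :\ e.
have [indJ | depJ] := boolP (J \in indep M); last first.
  by have [C cC sCJ] := @minset_exists _ [pred X | X \notin indep M] J depJ; exists C.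
have /subsetPn[g gC2 gC1] : ~~ (C2 \subset C1).
  have [_ minC1] := minsetP cC1.
  by apply: contra neqC => sC21; rewrite eq_sym; apply/eqP/minC1.
have indC2g : C2 :\ g \in indep M.
  apply: contraLR gC2 => dep.
  by have /setP/(_ g) := minC2 _ dep (subsetDl _ _); rewrite !inE eqxx => <-.
pose P := [pred X : {set E} | (X \in indep M) && (X \subset C1 :|: C2)].
have PC2g : P (C2 :\ g).
  by rewrite /= indC2g (subset_trans (subsetDl _ _) (subsetUr _ _)).
have [I /maxsetP[/= /andP[indI sI] maxI] sC2I] := maxset_exists PC2g.
have gI : g \notin I.
  apply: contra depC2 => gI; apply: indepS indI _.
  by rewrite -(setD1K gC2) subUset sub1set gI.
have /subsetPn[h hC1 hI] : ~~ (C1 \subset I).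
  by apply: contra depC1; apply: indepS indI.
have neq_hg : h != g by apply: contraNneq gC1 => <-.
(* Inside the union, [I] misses the two distinct elements [g] and [h], whereas [J] misses only
   [e]. *)
have ltIJ : #|I| < #|J|.
  have sI2 : I \subset (C1 :|: C2) :\ g :\ h.
    by apply/subsetP=> z zI; rewrite !inE -in_setU (subsetP sI) // andbT;
       apply/andP; split; apply: contraTneq zI => ->.
  apply: leq_ltn_trans (subset_leq_card sI2) _.
  have := cardsD1 e (C1 :|: C2); have := cardsD1 g (C1 :|: C2).
  have := cardsD1 h ((C1 :|: C2) :\ g).
  rewrite !inE eC1 hC1 gC2 neq_hg orbT /= !add1n => -> ->.
  by case=> <-.
have [x] := indep_aug indI indJ ltIJ.
rewrite !inE => /and3P[xI _ xC] indxI.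
have sxI : x |: I \subset C1 :|: C2 by rewrite subUset sub1set inE xC.
have Exi : x |: I = I by apply: maxI; rewrite ?indxI ?subsetUr.
by rewrite -Exi setU11 in xI.
Qed.

Lemma two_private_neighbors (G : sgraph) (v w u : G) :
  adj v w -> ~~ adj v u -> u != v -> degree w < degree u ->
  exists x y, [/\ x != y, [&& adj u x, ~~ adj w x & x != w]
                & [&& adj u y, ~~ adj w y & y != w]].
Proof.
move=> vw nvu neq_uv ltd.
set N := fun z : G => [set t | adj z t].
suff /card_gt1P[x [y [xP yP nxy]]] : 1 < #|(N u :\: N w) :\ w|.
  exists x, y; split=> //.
    by move: xP; rewrite !inE => /and3P[-> -> ->].
  by move: yP; rewrite !inE => /and3P[-> -> ->].
have ltD : #|N w :\: N u| < #|N u :\: N w|.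
  rewrite -(ltn_add2l #|N w :&: N u|) cardsID [N w :&: N u]setIC cardsID.
  exact: ltd.
have vD : v \in N w :\: N u by rewrite !inE adj_sym nvu adj_sym vw.
move: ltD; rewrite (cardsD1 w (N u :\: N w)) !inE adj_irrefl /=.
(* If [u] and [w] are adjacent, [w] itself lies in [N u :\: N w] and has to be discarded; the loss
   is made up by [u], which joins [v] in [N w :\: N u]. *)
have [uw | _] := boolP (adj u w); last first.
  by apply: leq_ltn_trans; apply/card_gt0P; exists v.
rewrite add1n ltnS; apply: leq_trans; apply/card_gt1P.
by exists u, v; split; rewrite // !inE adj_irrefl adj_sym uw.
Qed.

(** Common reduction for the three classes. An alternating 4-cycle of an induced subgraph is one of
    [G], so a hypothesis on [G] alone controls all induced subgraphs, and the classes need not be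
    shown hereditary. *)
Lemma strong_havel_hakimi_alternating4 (G : sgraph) :
  (forall v w u x y : G,
     alternating4 v w u x -> alternating4 v w u y -> x = y) ->
  strong_havel_hakimi G.
Proof.
move=> uniq_alt S v max_v; split=> // w u vw neq_uv nvu.
rewrite leqNgt; apply/negP=> /(two_private_neighbors vw nvu neq_uv).
have alt x : [&& adj u x, ~~ adj w x & x != w] ->
    alternating4 (val v) (val w) (val u) (val x).
  case/and3P=> ux nwx neq_xw; rewrite /alternating4.
  apply/and5P; split=> //; rewrite /= !inE !negb_or !(inj_eq val_inj).
  have neq_vw : v != w by apply: contraTneq vw => ->; rewrite adj_irrefl.
  have neq_vx : v != x by apply: contraNneq nvu => ->; rewrite adj_sym.
  have neq_wu : w != u by apply: contraNneq nvu => <-.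
  have neq_ux : u != x by apply: contraTneq ux => ->; rewrite adj_irrefl.
  by rewrite neq_vw (eq_sym v u) neq_uv neq_vx neq_wu (eq_sym w x) neq_xw neq_ux.
case=> x [y [/eqP neq_xy /alt altx /alt alty]].
by apply/neq_xy/val_inj/(uniq_alt _ _ _ _ _ altx alty).
Qed.

Lemma set4_seq (T : finType) (a b c d : T) :
  [set a; b; c; d] = [set z in [:: a; b; c; d]].
Proof. by apply/setP=> z; rewrite !inE !orbA. Qed.

Lemma alternating4_card (G : sgraph) (A : {set G}) :
  alternating4_vertex_set A -> #|A| = 4.
Proof.
case=> a [b [c [d [/andP[abcd _] ->]]]].
by rewrite set4_seq cardsE; apply/card_uniqP.
Qed.

(** Each vertex of an alternating 4-cycle lies on one of its two edges and on one of its two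
    non-edges. *)
Lemma alternating4_neighbors (G : sgraph) (A : {set G}) z :
  alternating4_vertex_set A -> z \in A ->
  (exists2 t, t \in A & adj z t) /\
  (exists2 t, t \in A & (t != z) && ~~ adj z t).
Proof.
case=> a [b [c [d [/and5P[abcd ab cd nac nbd] ->]]]].
move: abcd; rewrite /= !inE !negb_or -!andbA.
case/and5P=> _ neq_ac _ _ /and3P[neq_bd _ _].
rewrite -!orbA => /or4P[] /eqP->.
- by split; [exists b | exists c]; rewrite // ?inE ?eqxx ?orbT // eq_sym neq_ac.
- split; [exists a | exists d]; rewrite // ?inE ?eqxx ?orbT //.
    by rewrite adj_sym.
  by rewrite eq_sym neq_bd.
- split; [exists d | exists a]; rewrite // ?inE ?eqxx ?orbT //.
  by rewrite neq_ac adj_sym.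
- split; [exists c | exists b]; rewrite // ?inE ?eqxx ?orbT //.
    by rewrite adj_sym.
  by rewrite neq_bd adj_sym.
Qed.

Lemma matrogenic_alternating4_inj (G : sgraph) (v w u x y : G) :
  matrogenic G -> alternating4 v w u x -> alternating4 v w u y -> x = y.
Proof.
case=> M circM altx alty; apply: contraTeq isT => neq_xy.
have cx : circuit M [set v; w; u; x] by apply/circM; exists v, w, u, x.
have cy : circuit M [set v; w; u; y] by apply/circM; exists v, w, u, y.
have /and5P[uniqx _ ux _ nwx] := altx; have /and5P[_ _ uy _ nwy] := alty.
have neqC : [set v; w; u; x] != [set v; w; u; y].
  apply: contraTneq uniqx => /setP/(_ x); rewrite !inE eqxx orbT (negPf neq_xy) orbF.
  by move=> /esym /orP[/orP[]|] /eqP ->; rewrite /= !inE !eqxx ?orbT ?andbF.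
have [|| C cC sC] := circuit_elimination (e := v) cx cy neqC; try by rewrite !inE eqxx.
have altC : alternating4_vertex_set C by apply/circM.
have sC' : C \subset [set w; u; x; y].
  apply: subset_trans sC _; apply/subsetP=> z; rewrite !inE => /andP[/negPf->] /=.
  by case: (z == w) (z == u) (z == x) (z == y) => [] [] [] [].
(* Every circuit has exactly four elements, so [C] fills the set that bounds it. *)
have defC : C = [set w; u; x; y].
  apply/eqP; rewrite eqEcard sC' (alternating4_card altC) /=.
  by rewrite set4_seq cardsE card_size.
have wC : w \in C by rewrite defC !inE eqxx.
have uC : u \in C by rewrite defC !inE eqxx ?orbT.
have wu : adj w u.
  have [[t + wt] _] := alternating4_neighbors altC wC.
  rewrite defC !inE -!orbA => /or4P[] /eqP tE; move: wt; rewrite tE //.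
  - by rewrite adj_irrefl.
  - by rewrite (negPf nwx).
  - by rewrite (negPf nwy).
have [_ [t + /andP[neq_tu nut]]] := alternating4_neighbors altC uC.
rewrite defC !inE -!orbA (negPf neq_tu) /= => /or3P[] /eqP tE; move: nut; rewrite tE.
- by rewrite adj_sym wu.
- by rewrite ux.
- by rewrite uy.
Qed.

Lemma matroidal_alternating4_inj (G : sgraph) (v w u x y : G) :
  matroidal G -> alternating4 v w u x -> alternating4 v w u y -> x = y.
Proof.
case=> M circM altx alty; apply: contraTeq isT => neq_xy.
have /and5P[uniqx vw ux _ _] := altx; have /and5P[_ _ uy _ _] := alty.
have edgeP a b : adj a b -> exists e : edge G, val e = [set a; b].
  move=> ab; have abE : [set a; b] \in edges G.
    by apply/imsetP; exists (a, b); rewrite ?inE.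
  by exists (exist (fun e => e \in edges G) _ abE).
have [e eE] := edgeP _ _ vw; have [f fE] := edgeP _ _ ux; have [g gE] := edgeP _ _ uy.
have cf : circuit M [set e; f] by apply/circM; exists v, w, u, x, e, f.
have cg : circuit M [set e; g] by apply/circM; exists v, w, u, y, e, g.
(* [u] is an end of [f] but not of [e]. *)
have neq_ef : f != e.
  have uvw : u \notin [set v; w].
    move: uniqx; rewrite /= !inE !negb_or -!andbA => /and5P[_ neq_vu _ neq_wu _].
    by rewrite eq_sym neq_vu eq_sym neq_wu.
  by apply: contraNneq uvw => fe; rewrite -eE -fe fE !inE eqxx.
have neq_fg : f != g.
  apply/eqP=> /(congr1 val); rewrite fE gE => /setP/(_ x).
  rewrite !inE eqxx orbT (negPf neq_xy) orbF => /esym/eqP xu.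
  by rewrite xu adj_irrefl in ux.
have neqC : [set e; f] != [set e; g].
  by apply/eqP=> /setP/(_ f); rewrite !inE eqxx (negPf neq_ef) (negPf neq_fg).
have [|| C cC sC] := circuit_elimination (e := e) cf cg neqC; try by rewrite !inE eqxx.
have /circM[a [b [c [d [h [k [/andP[abcd _] hE kE CE]]]]]]] := cC.
(* With [e] eliminated, [C] lies in [[set f; g]], whose edges all pass through [u]; but [C] consists
   of the edges [h] and [k] of an alternating 4-cycle, which share no vertex. *)
have u_in z : z \in C -> u \in val z.
  move=> /(subsetP sC); rewrite !inE => /andP[/negPf->] /=.
  by case/orP=> /eqP ->; rewrite ?fE ?gE !inE eqxx.
have := u_in h; have := u_in k; rewrite CE hE kE !inE !eqxx orbT.
move=> /(_ isT) uk /(_ isT) uh; move: abcd.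
by case/orP: uk => /eqP <-; case/orP: uh => /eqP <-; rewrite /= !inE !eqxx ?orbT ?andbF.
Qed.

Theorem corollary2 (G : sgraph) :
  (matrogenic G -> strong_havel_hakimi G) /\
  (matroidal G -> strong_havel_hakimi G) /\
  (threshold G -> strong_havel_hakimi G).
Proof.
split; [| split] => hG; apply: strong_havel_hakimi_alternating4 => v w u x y.
- exact: matrogenic_alternating4_inj.
- exact: matroidal_alternating4_inj.
(* Without alternating 4-cycles, uniqueness of the fourth vertex is vacuous. *)
- by move=> altx; have := hG v w u x; rewrite altx.
Qed.
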